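(* Let $x\in\mathbb{R}^n$ and $k\ge 1$. There exists a randomized algorithm that performs $\mathcal{O}(k\log(k)+k\log\log(n))$ adaptive linear measurements on $x$ in $\mathcal{O}(\log\log(n))$ rounds, and with probability $1-1/\mathrm{poly}(k)$ returns a vector $\hat{x}\in\mathbb{R}^n$ such that $$\|x-\hat{x}\|_\infty^2\le\frac{1}{k}\|x_{-k}\|_2^2 .$$
   Context: Adaptive linear measurements: the algorithm accesses $x$ only through linear measurements $\langle a_i,x\rangle$, made in rounds, where the vectors in a round may depend on outcomes of earlier rounds. $x_{-k}\in\mathbb{R}^n$ is the vector obtained from $x$ by zeroing out its $k$ largest coordinates in absolute value. *)

(* Defs.v *)
From HB Require Import structures.
From mathcomp Require Import all_boot all_order all_algebra.
From mathcomp Require Import all_classical all_reals all_analysis.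
Set Implicit Arguments. Unset Strict Implicit. Unset Printing Implicit Defensive.
Import Order.TTheory GRing.Theory Num.Theory.
Local Open Scope ring_scope.

Section AdaptiveModel.
Variable R : realType.

Definition dotv (n : nat) (a x : 'rV[R]_n) : R := \sum_(i < n) a 0 i * x 0 i.

(* A randomized adaptive linear-measurement algorithm on R^n with random
   seed space Omega.  It runs [rounds] rounds; in each round, given the seed
   and the outcomes of all previous rounds (one list of outcomes per round),
   it chooses a finite list of measurement vectors (which may thus depend on
   earlier outcomes).  At the end it outputs an estimate from the seed and the
   full history of outcomes.  The input x is accessed only through the
   measurements <a_i, x>. *)
Record adaptive_alg (Omega : Type) (n : nat) := AdaptiveAlg {
  rounds : nat;
  query  : Omega -> seq (seq R) -> seq 'rV[R]_n;
  output : Omega -> seq (seq R) -> 'rV[R]_n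
}.

Fixpoint history (Omega : Type) (n : nat) (A : adaptive_alg Omega n)
  (w : Omega) (x : 'rV[R]_n) (r : nat) : seq (seq R) :=
  match r with
  | 0 => [::]
  | r'.+1 => let h := history A w x r' in
             rcons h [seq dotv a x | a <- query A w h]
  end.

Definition num_measurements (Omega : Type) (n : nat) (A : adaptive_alg Omega n)
  (w : Omega) (x : 'rV[R]_n) : nat :=
  (\sum_(r < rounds A) size (query A w (history A w x r)))%N.

Definition run (Omega : Type) (n : nat) (A : adaptive_alg Omega n)
  (w : Omega) (x : 'rV[R]_n) : 'rV[R]_n :=
  output A w (history A w x (rounds A)).

Definition is_top_set (n k : nat) (x : 'rV[R]_n) (S : {set 'I_n}) : bool :=
  (#|S| == minn k n) && [forall i in S, forall j in ~: S, `|x 0 j| <= `|x 0 i|].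

Definition top_set (n k : nat) (x : 'rV[R]_n) : {set 'I_n} :=
  odflt (finset.set0 : {set 'I_n}) [pick S : {set 'I_n} | is_top_set k x S].

Definition tail_vec (n k : nat) (x : 'rV[R]_n) : 'rV[R]_n :=
  \row_i (if i \in top_set k x then 0 else x 0 i).

Definition norm2_sq (n : nat) (v : 'rV[R]_n) : R := \sum_(i < n) v 0 i ^+ 2.

Definition norm_inf (n : nat) (v : 'rV[R]_n) : R := \big[Num.max/0]_(i < n) `|v 0 i|.

End AdaptiveModel.

(* log with the convention Log t = max(1, ln t), used inside O(.)-bounds so
   they are meaningful for small n, k. *)
Definition Log (R : realType) (t : R) : R := Num.max 1 (ln t).

(* Main.v *)
(** Coordinates of square above [tau = |x_{-k}|_2^2 / k] ("heavy") number at most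
2k, and the others have total energy at most [2 k tau].  Measuring every heavy
coordinate exactly, by a unit vector, leaves an error whose square is at most
[tau], so it suffices to locate O(k) candidates containing all heavy coordinates.

Every coordinate gets one uniform code in mixed radix.  Its lowest digit, modulo
poly(k), is a bucket number: with probability 1 - 1/poly(k) the heavy coordinates
lie in distinct buckets, and each such bucket has noise at most [tau / poly(k)].
A CountSketch over the poly(k) buckets, with O(log k) repetitions of O(k) cells,
selects O(k) buckets containing all the heavy ones.  In each selected bucket two signed
measurements [u = sum s_j x_j] and [v = sum digit_j s_j x_j] reveal the next digit
of the heavy coordinate as the integer nearest to [v / u], because the noise is small
compared to the radix.  Restricting to that digit divides the expected noise by
the radix, so the next radix may be larger: the modulus is squared every four
rounds, and after O(log log n) rounds the heavy coordinate is alone.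

For a fixed heavy coordinate the candidate sets that should occur depend on the
codes only, not on the signs or the outcomes, so that all failure events can be
bounded on a product space without conditioning on the adaptive history. *)
Require Import Defs.
From HB Require Import structures.
From mathcomp Require Import all_boot all_order all_algebra.
From mathcomp Require Import all_classical all_reals all_analysis.
From mathcomp Require Import ring lra zify.
Set Implicit Arguments. Unset Strict Implicit. Unset Printing Implicit Defensive.
Import Order.TTheory GRing.Theory Num.Theory.
Local Open Scope ring_scope.

(** * Expectation and probability under the uniform law on a finite type *)

Section UniformExpectation.
Context {R : realFieldType}.

Definition Ex (W : finType) (f : W -> R) : R := (\sum_w f w) / #|W|%:R.
Definition Pr (W : finType) (A : pred W) : R := Ex (fun w => (A w)%:R).

Arguments Ex W f : clear implicits.
Arguments Pr W A : clear implicits.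

Lemma eq_Ex {W : finType} (f g : W -> R) : f =1 g -> Ex W f = Ex W g.
Proof. by move=> fg; rewrite /Ex; under eq_bigr do rewrite fg. Qed.

Lemma ler_Ex {W : finType} (f g : W -> R) :
  (forall w, f w <= g w) -> Ex W f <= Ex W g.
Proof. by move=> fg; rewrite ler_wpM2r ?invr_ge0 ?ler_sum. Qed.

Lemma Ex_ge0 {W : finType} (f : W -> R) : (forall w, 0 <= f w) -> 0 <= Ex W f.
Proof. by move=> f0; rewrite divr_ge0 ?sumr_ge0. Qed.

Lemma Ex_sum {W I : finType} (P : pred I) (f : I -> W -> R) :
  Ex W (fun w => \sum_(i | P i) f i w) = \sum_(i | P i) Ex W (f i).
Proof. by rewrite /Ex exchange_big mulr_suml. Qed.

Lemma ExD {W : finType} (f g : W -> R) :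
  Ex W (fun w => f w + g w) = Ex W f + Ex W g.
Proof. by rewrite /Ex big_split mulrDl. Qed.

Lemma ExZl {W : finType} (a : R) (f : W -> R) :
  Ex W (fun w => a * f w) = a * Ex W f.
Proof. by rewrite /Ex -mulr_sumr mulrA. Qed.

Lemma Ex_cst {W : finType} (a : R) : (0 < #|W|)%N -> Ex W (fun=> a) = a.
Proof.
move=> W0; rewrite /Ex sumr_const -[a *+ _]mulr_natr mulfK //.
by rewrite pnatr_eq0 -lt0n.
Qed.

(** On an empty sample space the average is 0, so nonnegativity of [a] can replace nonemptiness. *)
Lemma Ex_cst_le {W : finType} (a : R) : 0 <= a -> Ex W (fun=> a) <= a.
Proof.
move=> a0; have [W0|W0] := posnP #|W|; last by rewrite Ex_cst.
by rewrite /Ex W0 invr0 mulr0.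
Qed.

Lemma Ex_le_cst {W : finType} (f : W -> R) (a : R) :
  0 <= a -> (forall w, f w <= a) -> Ex W f <= a.
Proof. by move=> a0 fa; apply: le_trans (Ex_cst_le a0); exact: ler_Ex. Qed.

Lemma Ex_prod {V W : finType} (f : V * W -> R) :
  Ex _ f = Ex V (fun v => Ex W (fun w => f (v, w))).
Proof.
rewrite /Ex card_prod natrM invfM mulrA -mulr_suml.
rewrite (eq_bigr (fun p => f (p.1, p.2))) => [|[]//].
by rewrite -(pair_bigA _ (fun v w => f (v, w))) /= mulrAC.
Qed.

(** The values of a uniform function are independent: distribute the product of sums over all
    functions. *)
Lemma Ex_ffun {I J : finType} (F : I -> J -> R) :
  Ex {ffun I -> J} (fun f => \prod_i F i (f i)) = \prod_i Ex J (F i).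
Proof.
rewrite /Ex -bigA_distr_bigA card_ffun big_split /= prodr_const.
by rewrite natrX exprVn.
Qed.

(** Follows from [Ex_ffun] with the constant factor 1 at every other index. *)
Lemma Ex_ffun2 {I J : finType} (i j : I) (phi psi : J -> R) :
  (0 < #|J|)%N -> i != j ->
  Ex {ffun I -> J} (fun f => phi (f i) * psi (f j)) = Ex J phi * Ex J psi.
Proof.
move=> J0 ij.
pose F l := if l == i then phi else if l == j then psi else fun=> 1.
have Fj : F j = psi by rewrite /F eq_sym (negPf ij) eqxx.
rewrite -[LHS](_ : Ex _ (fun f : {ffun I -> J} => \prod_l F l (f l)) = _).
  rewrite Ex_ffun (bigD1 i) //= (bigD1 j) 1?eq_sym //= Fj.
  rewrite {1}/F eqxx big1 ?mulr1 // => l /andP[/negPf li /negPf lj].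
  by rewrite /F li lj Ex_cst.
apply: eq_Ex => f; rewrite (bigD1 i) //= (bigD1 j) 1?eq_sym //= Fj.
rewrite {1}/F eqxx big1 ?mulr1 // => l /andP[/negPf li /negPf lj].
by rewrite /F li lj.
Qed.

Lemma Pr_prod {V W : finType} (A : pred (V * W)) :
  Pr _ A = Ex V (fun v => Pr W (fun w => A (v, w))).
Proof. exact: Ex_prod. Qed.

Lemma Pr_le1 {W : finType} (A : pred W) : Pr W A <= 1.
Proof. by apply: Ex_le_cst => // w; case: (A w). Qed.

Lemma Pr_set0 {W : finType} (A : pred W) : (forall w, ~~ A w) -> Pr W A = 0.
Proof.
by move=> A0; rewrite /Pr /Ex big1 ?mul0r // => w _; rewrite (negPf (A0 w)).
Qed.

Lemma PrU {W : finType} (A B : pred W) :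
  Pr W (fun w => A w || B w) <= Pr W A + Pr W B.
Proof. by rewrite -ExD; apply: ler_Ex => w; case: (A w); case: (B w) => /=; lra. Qed.

Lemma Pr_exists {W I : finType} (P : pred I) (A : I -> pred W) :
  Pr W (fun w => [exists (i | P i), A i w]) <= \sum_(i | P i) Pr W (A i).
Proof.
rewrite -Ex_sum; apply: ler_Ex => w.
case: existsP => [[i /andP[Pi Aiw]]|_]; last by rewrite sumr_ge0.
by rewrite (bigD1 i) //= Aiw lerDl sumr_ge0.
Qed.

Lemma Pr_exists_le {W I : finType} (P : pred I) (A : I -> pred W) (k : nat) (p : R) :
  (#|P| <= k)%N -> 0 <= p -> (forall i, P i -> Pr W (A i) <= p) ->
  Pr W (fun w => [exists (i | P i), A i w]) <= k%:R * p.
Proof.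
move=> Pk p0 Ap; apply: le_trans (Pr_exists _ _) _.
apply: (@le_trans _ _ (#|P|%:R * p)); last by rewrite ler_wpM2r // ler_nat.
by rewrite mulr_natl -sumr_const; exact: ler_sum.
Qed.

Lemma Pr_fst {V W : finType} (A : pred V) : Pr (V * W)%type (fun p => A p.1) <= Pr V A.
Proof. by rewrite Pr_prod; apply: ler_Ex => v; apply: (@Ex_cst_le W (A v)%:R). Qed.

Lemma markov_le {W : finType} (f : W -> R) (a e : R) : 0 < a ->
  (forall w, 0 <= f w) -> Ex W f <= a * e -> Pr W (fun w => a < f w) <= e.
Proof.
move=> a0 f0 fe; rewrite -(ler_pM2l a0); apply: le_trans fe.
rewrite -ExZl; apply: ler_Ex => w; case: ltP => [/ltW|_].
  by rewrite mulr1.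
by rewrite mulr0.
Qed.

Definition sgn (b : bool) : R := (-1) ^+ b.

Lemma Ex_sgn : Ex bool sgn = 0.
Proof. by rewrite /Ex big_bool /sgn /= expr0 expr1 addrC subrr mul0r. Qed.

(* Pairwise independence of the signs kills the cross terms. *)
Lemma Ex_sgn_sq {I : finType} (P : pred I) (c : I -> R) :
  Ex {ffun I -> bool} (fun s => (\sum_(j | P j) sgn (s j) * c j) ^+ 2)
  = \sum_(j | P j) c j ^+ 2.
Proof.
rewrite (eq_Ex (g := fun s : {ffun I -> bool} => \sum_(i | P i) \sum_(j | P j)
    (c i * c j) * (sgn (s i) * sgn (s j)))); last first.
  move=> s; rewrite expr2 mulr_suml; apply: eq_bigr => i _.
  by rewrite mulr_sumr; apply: eq_bigr => j _; ring.
rewrite Ex_sum; apply: eq_bigr => i Pi; rewrite Ex_sum (bigD1 i) //=.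
rewrite [X in _ + X]big1 ?addr0 => [|j /andP[Pj ji]].
  rewrite (eq_Ex (g := fun=> c i ^+ 2)) => [|s]; last first.
    by rewrite -!expr2 /sgn sqrr_sign mulr1.
  by rewrite Ex_cst // card_ffun card_bool expn_gt0.
by rewrite ExZl Ex_ffun2 1?eq_sym ?card_bool // Ex_sgn mul0r mulr0.
Qed.

(** Given [f i = a], the value [f j] is still uniform, and the class of [a] has proportion at most
    [1 / m]. Serves both for congruent codes and for hash collisions. *)
Lemma Pr_coll {I J : finType} (rel : J -> J -> bool) (m : nat) (i j : I) :
  i != j -> (0 < m)%N ->
  (forall a, #|[pred b | rel a b]| * m <= #|J|)%N ->
  Pr {ffun I -> J} (fun f => rel (f i) (f j)) <= m%:R^-1.
Proof.
move=> ij m0 relm; rewrite /Pr.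
rewrite (eq_Ex (g := fun f : {ffun I -> J} =>
    \sum_a (f i == a)%:R * (rel a (f j))%:R)); last first.
  move=> f; rewrite (bigD1 (f i)) //= eqxx mul1r big1 ?addr0 // => a.
  by rewrite eq_sym => /negPf ->; rewrite mul0r.
rewrite Ex_sum.
have [J0|J0] := posnP #|J|.
  by rewrite big1 ?invr_ge0 ?ler0n // => a; have := fintype0 a J0.
have JR : 0 < #|J|%:R :> R by rewrite ltr0n.
have mR : 0 < m%:R :> R by rewrite ltr0n.
apply: (@le_trans _ _ (\sum_(a : J) #|J|%:R^-1 * m%:R^-1)); last first.
  by rewrite sumr_const -[X in X <= _]mulr_natr mulrAC mulVf ?mul1r ?lt0r_neq0.
apply: ler_sum => a _; rewrite (Ex_ffun2 (fun b => (b == a)%:R) (fun b => (rel a b)%:R)) //.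
have -> : Ex J (fun b => (b == a)%:R) = #|J|%:R^-1.
  rewrite /Ex (bigD1 a) //= eqxx big1 ?addr0 ?mul1r // => b /negPf -> //.
rewrite ler_pM2l ?invr_gt0 // /Ex ler_pdivrMr // mulrC ler_pdivlMr //.
rewrite -natr_sum -natrM ler_nat; apply: leq_trans (relm a).
rewrite leq_mul2r -sum1_card big_mkcond /= [X in (_ <= X)%N]big_mkcond orbC.
by rewrite leq_sum // => b _; rewrite inE; case: rel.
Qed.

(* The moment [E 16^(number of bad trials) <= 2^t] replaces a Chernoff bound. *)
Lemma Pr_majority {J : finType} (t : nat) (bad : pred J) :
  Pr J bad <= 15^-1 -> (0 < #|J|)%N ->
  Pr {ffun 'I_t -> J} (fun f => (t <= 2 * #|[pred s | bad (f s)]|)%N)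
  <= 2^-1 ^+ t.
Proof.
move=> badp J0.
have E16 (f : {ffun 'I_t -> J}) : 16 ^+ #|[pred s | bad (f s)]|
    = \prod_(s < t) (1 + 15 * (bad (f s))%:R) :> R.
  rewrite -prodr_const big_mkcond /=; apply: eq_bigr => s _.
  by rewrite inE; case: (bad _); rewrite ?mulr1 ?mulr0 ?addr0 // -natrD.
(* When at least half of the trials are bad, 16 to their number is at least [4 ^ t], so the
   indicator is at most [4 ^ -t] times that power. *)
apply: (@le_trans _ _ (Ex {ffun 'I_t -> J}
    (fun f => 4^-1 ^+ t * \prod_(s < t) (1 + 15 * (bad (f s))%:R)))).
  apply: ler_Ex => f; rewrite -E16.
  case: leqP => [tb|_]; last by rewrite mulr_ge0 ?exprn_ge0 ?invr_ge0 ?ler0n.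
  rewrite exprVn mulrC ler_pdivlMr ?exprn_gt0 // mul1r.
  rewrite (_ : 16 = 4 ^+ 2); last by rewrite expr2 -natrM.
  by rewrite -exprM ler_weXn2l // ler1n.
rewrite ExZl (Ex_ffun (fun _ b => 1 + 15 * (bad b)%:R)) prodr_const card_ord.
rewrite -exprMn lerXn2r ?nnegrE ?invr_ge0 ?ler0n //.
  by rewrite mulr_ge0 ?invr_ge0 ?ler0n // Ex_ge0 // => b; case: (bad b); lra.
rewrite ExD Ex_cst // ExZl -[Ex J _]/(Pr J bad); lra.
Qed.

End UniformExpectation.

Arguments Ex {R} W f.
Arguments Pr {R} W A.

(** * Adaptive algorithms presented as state machines *)

Section StateMachine.
Context {R : realType} {Om W St : Type} {n : nat}.
Variables (s0 : St) (ask : W -> nat -> St -> seq 'rV[R]_n).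
Variables (upd : W -> nat -> St -> seq R -> St) (out : St -> 'rV[R]_n).

Definition replay (w : W) (h : seq (seq R)) : nat * St :=
  foldl (fun ms ans => (ms.1.+1, upd w ms.1 ms.2 ans)) (0%N, s0) h.

(** An adaptive algorithm sees only past outcomes, so the round number and the state are recomputed
    by replaying them. *)
Definition machine (seed : Om -> W) (rds : nat) : adaptive_alg R Om n :=
  {| rounds := rds;
     query := fun w h => let ms := replay (seed w) h in ask (seed w) ms.1 ms.2;
     output := fun w h => out (replay (seed w) h).2 |}.

Fixpoint state (w : W) (x : 'rV[R]_n) (m : nat) : St :=
  if m is m'.+1 then
    let s := state w x m' in upd w m' s [seq dotv a x | a <- ask w m' s]
  else s0.

Lemma replay_history (seed : Om -> W) (rds : nat) w x m :
  replay (seed w) (history (machine seed rds) w x m) = (m, state (seed w) x m).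
Proof.
elim: m => // m IH.
by rewrite /replay /= foldl_rcons -/(replay _ _) IH.
Qed.

Lemma run_machine (seed : Om -> W) (rds : nat) w x :
  run (machine seed rds) w x = out (state (seed w) x rds).
Proof. by rewrite /run /= -/(machine seed rds) replay_history. Qed.

Lemma num_measurements_machine (seed : Om -> W) (rds : nat) w x :
  num_measurements (machine seed rds) w x =
  (\sum_(m < rds) size (ask (seed w) m (state (seed w) x m)))%N.
Proof.
by apply: eq_bigr => m _ /=; rewrite -/(machine seed rds) replay_history.
Qed.

End StateMachine.

Definition look {Q : eqType} {R : realType} (s : seq Q) (ans : seq R) (p : Q) : R :=
  nth 0 ans (index p s).

Lemma look_map {R : realType} {n : nat} {Q : eqType} (s : seq Q)
    (f : Q -> 'rV[R]_n) (x : 'rV[R]_n) p : p \in s ->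
  look s [seq dotv a x | a <- [seq f p | p <- s]] p = dotv (f p) x.
Proof.
by move=> ps; rewrite /look -map_comp (nth_map p) ?index_mem // nth_index.
Qed.

(** * Selection of a superlevel set of bounded size *)

Section Selection.
Context {R : realType} {I : finType}.

Definition admissible (L : nat) (D : R -> {set I}) (A : {set I}) : bool :=
  (#|A| <= L)%N && ((A == finset.set0) || `[< exists th, A = D th >]).

(** The right threshold depends on the unknown tail of [x]; the largest superlevel set that fits is
    computable without it. *)
Definition select (L : nat) (D : R -> {set I}) : {set I} :=
  [arg max_(A > finset.set0 | admissible L D A) #|A|].

Lemma select_spec L (D : R -> {set I}) :
  extremum_spec geq (admissible L D) (fun A => #|A|) (select L D).
Proof. by apply: arg_maxnP; rewrite /admissible cards0 eqxx. Qed.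

Lemma card_select L (D : R -> {set I}) : (#|select L D| <= L)%N.
Proof. by case: select_spec => A /andP[]. Qed.

(* Superlevel sets form a chain, so the largest admissible one contains all. *)
Lemma sub_select L (D : R -> {set I}) th :
  (forall a b, a <= b -> D b \subset D a) -> (#|D th| <= L)%N ->
  D th \subset select L D.
Proof.
move=> antiD DL; case: select_spec => A /andP[_ PA] /(_ (D th)) maxA.
have {}maxA : (#|D th| <= #|A|)%N.
  by apply: maxA; rewrite /admissible DL; apply/orP; right; apply/asboolP; exists th.
case/orP: PA => [/eqP A0|/asboolP[th' A']].
  by move: maxA; rewrite A0 cards0 leqn0 cards_eq0 => /eqP ->; rewrite finset.sub0set.
have [le|/ltW le] := leP th' th; first by rewrite A' antiD.
have: A \subset D th by rewrite A' antiD.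
move=> AD; suff -> : A = D th by [].
by apply/eqP; rewrite eqEcard AD.
Qed.

End Selection.

Lemma dotv_delta {R : realType} {n : nat} (x : 'rV[R]_n) j : dotv (delta_mx 0 j) x = x 0 j.
Proof.
rewrite /dotv (bigD1 j) //= mxE !eqxx mul1r big1 ?addr0 // => i /negPf ij.
by rewrite mxE ij andbF mul0r.
Qed.

(** * The recovery algorithm and its measurement count *)

Section Algorithm.
Context {R : realType}.
Variables (n N B T L r : nat) (M rad : nat -> nat) (N_gt0 : (0 < N)%N).

(** Codes and probe signs of the coordinates, then [T] sketch trials, each with a hash from buckets
    to cells and its own signs. *)
Definition seeds : finType :=
  (({ffun 'I_n -> 'I_(M r)} * {ffun 'I_n -> bool}) *
   {ffun 'I_T -> {ffun 'I_N -> 'I_B} * {ffun 'I_n -> bool}})%type.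

Definition bucket (a : nat) : 'I_N := Ordinal (ltn_pmod a N_gt0).
Definition digit (m a : nat) : nat := (a %/ M m %% rad m)%N.

(* The selected buckets, the candidate set of each bucket, the estimate. *)
Definition alg_state : Type :=
  {set 'I_N} * ('I_N -> {set 'I_n}) * 'rV[R]_n.

(** The hash acts on bucket numbers, so a whole bucket falls into one cell. *)
Definition sketch (w : seeds) (p : 'I_T * 'I_B) : 'rV[R]_n :=
  \row_j (if (w.2 p.1).1 (bucket (w.1.1 j)) == p.2 then sgn ((w.2 p.1).2 j) else 0).

Definition probe (w : seeds) (m : nat) (A : {set 'I_n}) (c : bool) : 'rV[R]_n :=
  \row_j (if j \in A then
            (if c then (digit m (w.1.1 j))%:R else 1) * sgn (w.1.2 j) else 0).

Definition probes (D : {set 'I_N}) : seq ('I_N * bool) :=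
  enum [set p : 'I_N * bool | p.1 \in D].

Definition resolved (s : alg_state) : {set 'I_n} :=
  [set j | [exists b in s.1.1, s.1.2 b == [set j]]].

Definition ask_round (w : seeds) (m : nat) (s : alg_state) : seq 'rV[R]_n :=
  if m is m'.+1 then
    if (m' < r)%N then [seq probe w m' (s.1.2 p.1) p.2 | p <- probes s.1.1]
    else [seq delta_mx 0 j | j <- enum (resolved s)]
  else [seq sketch w p | p <- enum {: 'I_T * 'I_B}].

(** Plays the role of thresholding the CountSketch median at [th]. *)
Definition majority (w : seeds) (z : 'I_T * 'I_B -> R) (th : R) : {set 'I_N} :=
  [set b | (T < 2 * #|[pred t | (th <= `|z (t, (w.2 t).1 b)|)%R]|)%N].

(** The test that the digit is nearest to [v / u], cleared of the division; nothing survives when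
    [u = 0]. *)
Definition refine (w : seeds) (m : nat) (A : {set 'I_n}) (u v : R) : {set 'I_n} :=
  [set j in A | `|v - (digit m (w.1.1 j))%:R * u| < `|u| / 2].

Definition upd_round (w : seeds) (m : nat) (s : alg_state) (ans : seq R) : alg_state :=
  if m is m'.+1 then
    if (m' < r)%N then
      let a p := look (probes s.1.1) ans p in
      (s.1.1, fun b => refine w m' (s.1.2 b) (a (b, false)) (a (b, true)), 0)
    else
      (s.1, \row_j (if j \in resolved s then look (enum (resolved s)) ans j else 0))
  else
    (select L (majority w (look (enum {: 'I_T * 'I_B}) ans)),
     fun b => [set j | bucket (w.1.1 j) == b], 0).

Definition state0 : alg_state := (finset.set0, fun=> finset.set0, 0).

(** One sketch round, [r] refinement rounds and one round of exact readings. *)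
Definition recovery {Om : Type} (seed : Om -> seeds) : adaptive_alg R Om n :=
  machine state0 ask_round upd_round snd seed r.+2.

Notation stat := (state state0 ask_round upd_round).

Lemma state_round0 w x :
  stat w x 1 = (select L (majority w (fun p => dotv (sketch w p) x)),
                fun b => [set j | bucket (w.1.1 j) == b], 0).
Proof.
rewrite /=; congr (select L (majority w _), _, _); apply/funext => p.
by rewrite look_map // mem_enum.
Qed.

Lemma state_refine w x m b : (m < r)%N -> b \in (stat w x m.+1).1.1 ->
  (stat w x m.+2).1.2 b =
  refine w m ((stat w x m.+1).1.2 b)
    (dotv (probe w m ((stat w x m.+1).1.2 b) false) x)
    (dotv (probe w m ((stat w x m.+1).1.2 b) true) x).
Proof.
move=> mr bD; rewrite [stat w x m.+2]/= -/(stat w x m.+1).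
set s := stat w x m.+1 in bD *; rewrite /upd_round /ask_round mr /=.
by rewrite !look_map // mem_enum inE.
Qed.

Lemma state_selected w x m : (m <= r)%N ->
  (stat w x m.+1).1.1 = select L (majority w (fun p => dotv (sketch w p) x)).
Proof.
elim: m => [|m IH] mr; first by rewrite state_round0.
rewrite [stat w x m.+2]/= -/(stat w x m.+1) /upd_round mr /=.
by rewrite -IH // ltnW.
Qed.

Lemma recovery_run {Om : Type} (seed : Om -> seeds) w x :
  run (recovery seed) w x =
  \row_j (if j \in resolved (stat (seed w) x r.+1) then x 0 j else 0).
Proof.
rewrite run_machine [stat _ _ r.+2]/= -/(stat (seed w) x r.+1).
set s := stat _ _ _; rewrite /upd_round /ask_round ltnn /=.
apply/rowP => j; rewrite !mxE; case: ifP => // js.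
by rewrite look_map ?mem_enum // dotv_delta.
Qed.

(** A resolved coordinate is the whole candidate set of some selected bucket, so choosing such a
    bucket is injective. *)
Lemma card_resolved s : (#|resolved s| <= #|s.1.1|)%N.
Proof.
pose f (j : 'I_n) := odflt (Ordinal N_gt0) [pick b in s.1.1 | s.1.2 b == [set j]].
have fP j : j \in resolved s -> f j \in s.1.1 /\ s.1.2 (f j) = [set j].
  rewrite inE /f => /existsP[b /andP[bD bj]].
  by case: pickP => [c /andP[? /eqP ?]//|/(_ b)]; rewrite bD bj.
rewrite -(@card_in_imset _ _ f) => [|i j /fP[_ ei] /fP[_ ej] eij].
  by apply/subset_leq_card/fintype.subsetP => _ /imsetP[j /fP[? _] ->].
by apply/set1P; rewrite -ej -eij ei set11.
Qed.

Lemma recovery_measurements {Om : Type} (seed : Om -> seeds) w x :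
  (num_measurements (recovery seed) w x <= T * B + r * (2 * L) + L)%N.
Proof.
rewrite num_measurements_machine big_ord_recr big_ord_recl /= -/(stat (seed w) x r.+1).
have selL m : (m <= r)%N -> (#|(stat (seed w) x m.+1).1.1| <= L)%N.
  by move=> mr; rewrite state_selected // card_select.
rewrite ltnn !size_map -!cardE leq_add //; last first.
  exact: leq_trans (card_resolved _) (selL r _).
rewrite leq_add //.
  by rewrite -enumT -cardT card_prod !card_ord.
rewrite -[X in (X * _)%N](card_ord r) -sum_nat_const leq_sum // => i _.
rewrite add0n ltn_ord size_map -/(stat (seed w) x i.+1).
set D := (X in probes X).
have -> : size (probes D) = (2 * #|D|)%N.
  have -> : (2 * #|D|)%N = #|finset.setX D [set: bool]%SET|.
    by rewrite cardsX cardsT card_bool mulnC.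
  by rewrite -cardE; apply: eq_card => -[a c]; rewrite !inE /= andbT.
by rewrite leq_mul2l /= selL // ltnW.
Qed.

End Algorithm.

Lemma sqr_le_norm {R : realDomainType} (a e : R) : 0 <= a -> e ^+ 2 <= a ^+ 2 -> `|e| <= a.
Proof. by move=> a0 ea; rewrite -ler_sqr ?nnegrE // real_normK ?num_real. Qed.

Lemma norm_sgnM {R : realFieldType} b (y : R) : `|sgn b * y| = `|y|.
Proof. by rewrite normrM /sgn normrX normrN1 expr1n mul1r. Qed.

(** Mixed-radix expansion: [c %% (m * d)] has low part [c %% m] and next digit [c %/ m %% d]. *)
Lemma eqn_mod_mul (a b m d : nat) : (0 < m)%N ->
  (a == b %[mod m * d]) = (a == b %[mod m]) && (a %/ m %% d == b %/ m %% d)%N.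
Proof.
move=> m0; have E c : (c %% (m * d) = c %/ m %% d * m + c %% m)%N.
  rewrite modn_divl [(d * m)%N]mulnC -[X in _ = (_ + X)%N](modn_dvdm c (dvdn_mulr d (dvdnn m))).
  exact: divn_eq.
apply/eqP/andP => [e|[/eqP e1 /eqP e2]]; last by rewrite !E e1 e2.
have e1 : a = b %[mod m].
  by rewrite -(modn_dvdm a (dvdn_mulr d (dvdnn m))) e modn_dvdm ?dvdn_mulr.
split; apply/eqP => //.
by apply/eqP; rewrite -(eqn_pmul2r m0) -(eqn_add2r (a %% m)) -E e E e1.
Qed.

(** * Failure events of the seed for a fixed input *)

Section Correctness.
Context {R : realType}.
Variables (n N B T L r : nat) (M rad : nat -> nat) (N_gt0 : (0 < N)%N).
Hypothesis M0 : M 0%N = N.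
Hypothesis MS : forall m, M m.+1 = (M m * rad m)%N.
Hypothesis rad_gt0 : forall m, (0 < rad m)%N.

(** The heavy set [H] and the scale [s] belong to the analysis; the algorithm never reads them. *)
Variables (x : 'rV[R]_n) (H : {set 'I_n}) (K : nat) (s : R).
Hypothesis s_gt0 : 0 < s.
Hypothesis card_H : (#|H| <= K)%N.
Hypothesis heavy : forall i, i \in H -> s <= `|x 0 i|.
Hypothesis light : \sum_(j | j \notin H) x 0 j ^+ 2 <= K%:R * s ^+ 2.

Lemma M_gt0 m : (0 < M m)%N.
Proof. by elim: m => [|m IH]; rewrite ?M0 // MS muln_gt0 IH rad_gt0. Qed.

Lemma M_dvd m l : (m <= l)%N -> (M m %| M l)%N.
Proof.
elim: l => [|l IH]; first by rewrite leqn0 => /eqP ->.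
rewrite leq_eqVlt ltnS => /orP[/eqP -> //|/IH]; rewrite MS; exact: dvdn_mulr.
Qed.

Local Notation trial := ({ffun 'I_N -> 'I_B} * {ffun 'I_n -> bool})%type.
Local Notation bucket := (bucket N_gt0).

Definition energy (h : 'I_n -> 'I_N) (b : 'I_N) : R :=
  \sum_(j | (j \notin H) && (h j == b)) x 0 j ^+ 2.

Definition trial_noise (h : 'I_n -> 'I_N) (b : 'I_N) (p : trial) : R :=
  \sum_(j | (j \notin H) && (p.1 (h j) == p.1 b)) sgn (p.2 j) * x 0 j.

(** The noise level [s / 4] is half of the detection threshold [s / 2]. *)
Definition bad_trial (h : 'I_n -> 'I_N) (b : 'I_N) (p : trial) : bool :=
  [exists (i | (i \in H) && (h i != b)), p.1 (h i) == p.1 b] ||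
  ((s / 4) ^+ 2 < trial_noise h b p ^+ 2).

Definition congr_mod (m : nat) (a b : nat) : bool := b == a %[mod M m].

(** Weight of a light coordinate in the noise: in [v - digit_i * u] when [c] is true, in [u]
    otherwise. *)
Definition offset (m : nat) (c : bool) (a b : nat) : R :=
  if c then (digit M rad m b)%:R - (digit M rad m a)%:R else 1.

Definition probe_noise (m : nat) (i : 'I_n) (c : bool)
    (p : {ffun 'I_n -> 'I_(M r)} * {ffun 'I_n -> bool}) : R :=
  \sum_(j | (j \notin H) && congr_mod m (p.1 i) (p.1 j))
    sgn (p.2 j) * (offset m c (p.1 i) (p.1 j) * x 0 j).

Definition heavy_collide (g : {ffun 'I_n -> 'I_(M r)}) : bool :=
  [exists (i | i \in H), exists (j | (j \in H) && (i != j)), congr_mod 0 (g i) (g j)].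

Definition code_collide (g : {ffun 'I_n -> 'I_(M r)}) : bool :=
  [exists (i | i \in H), exists (j | i != j), congr_mod r (g i) (g j)].

Definition bucket_overload (g : {ffun 'I_n -> 'I_(M r)}) : bool :=
  [exists (i | i \in H),
     s ^+ 2 / 512 < energy (fun j => bucket (g j)) (bucket (g i))].

(** Only buckets of small energy must have a good majority; overloaded ones may be selected wrongly,
    but they are few. *)
Definition sketch_fail (w : seeds n N B T r M) : bool :=
  [exists b, (energy (fun j => bucket (w.1.1 j)) b <= s ^+ 2 / 512) &&
    (T <= 2 * #|[pred t | bad_trial (fun j => bucket (w.1.1 j)) b (w.2 t)]|)%N].

Definition probe_fail (p : {ffun 'I_n -> 'I_(M r)} * {ffun 'I_n -> bool}) : bool :=
  [exists m : 'I_r, exists (i | i \in H), exists c,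
     (s / 8) ^+ 2 < probe_noise m i c p ^+ 2].

Definition fail (w : seeds n N B T r M) : bool :=
  [|| heavy_collide w.1.1, code_collide w.1.1, bucket_overload w.1.1,
      sketch_fail w | probe_fail w.1].

Lemma congr_mod0 a b : congr_mod 0 a b = (bucket b == bucket a).
Proof. by rewrite /congr_mod M0. Qed.

Lemma congr_modS m a b :
  congr_mod m.+1 a b = congr_mod m a b && (digit M rad m b == digit M rad m a).
Proof. by rewrite /congr_mod MS eqn_mod_mul ?M_gt0. Qed.

Lemma congr_modW m l a b : (m <= l)%N -> congr_mod l a b -> congr_mod m a b.
Proof.
move=> /M_dvd ml /eqP e; apply/eqP.
by rewrite -(modn_dvdm b ml) e modn_dvdm.
Qed.

(** * Deterministic correctness outside the failure events *)

Section GoodSeed.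
Variable w : seeds n N B T r M.
Hypothesis good : ~~ fail w.

Local Notation g := (w.1.1).
Local Notation h := (fun j => bucket (w.1.1 j)).
Local Notation stat := (state (state0 n N) (ask_round rad N_gt0) (upd_round L rad N_gt0)).

Lemma goodP : [/\ ~~ heavy_collide g, ~~ code_collide g, ~~ bucket_overload g,
  ~~ sketch_fail w & ~~ probe_fail w.1].
Proof. by move: good; rewrite /fail !negb_or => /and5P. Qed.

Lemma heavy_inj i j : i \in H -> j \in H -> h i = h j -> i = j.
Proof.
move=> iH jH hij; apply/eqP; have [/negP F _ _ _ _] := goodP.
apply/negPn/negP => ij; apply: F; apply/existsP; exists i; rewrite iH.
by apply/existsP; exists j; rewrite jH ij congr_mod0 hij eqxx.
Qed.

Lemma sketch_split b t :
  (forall i, i \in H -> h i != b -> (w.2 t).1 (h i) != (w.2 t).1 b) ->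
  dotv (sketch N_gt0 w (t, (w.2 t).1 b)) x =
  \sum_(j | (j \in H) && (h j == b)) sgn ((w.2 t).2 j) * x 0 j +
  trial_noise h b (w.2 t).
Proof.
move=> nocoll; rewrite /dotv /trial_noise.
rewrite (eq_bigr (fun j => if (w.2 t).1 (h j) == (w.2 t).1 b
    then sgn ((w.2 t).2 j) * x 0 j else 0)); last first.
  by move=> j _; rewrite mxE /=; case: ifP => // _; rewrite mul0r.
rewrite -big_mkcond (bigID (mem H)) /=; congr (_ + _); apply: eq_bigl => j.
  rewrite andbC; case jH: (j \in H) => //=.
  by have [->|/(nocoll _ jH)/negPf] := eqVneq (h j) b; rewrite ?eqxx.
by rewrite andbC.
Qed.

Lemma sketch_noise b t : ~~ bad_trial h b (w.2 t) ->
  `|trial_noise h b (w.2 t)| <= s / 4 /\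
  (forall i, i \in H -> h i != b -> (w.2 t).1 (h i) != (w.2 t).1 b).
Proof.
rewrite negb_or -leNgt => /andP[/existsPn F le]; split.
  by apply: sqr_le_norm le; rewrite divr_ge0 // ltW.
by move=> i iH ib; have := F i; rewrite iH ib.
Qed.

Lemma sketch_light b t : ~~ bad_trial h b (w.2 t) ->
  (forall i, i \in H -> h i != b) ->
  `|dotv (sketch N_gt0 w (t, (w.2 t).1 b)) x| < s / 2.
Proof.
move=> /sketch_noise[le nocoll] nH; rewrite sketch_split // big1 ?add0r.
  by apply: le_lt_trans le _; have := s_gt0; lra.
by move=> i /andP[/nH/negPf ->].
Qed.

(** The cell holds [i] as its only heavy coordinate, so its magnitude is at least [s - s / 4]. *)
Lemma sketch_heavy i t : i \in H -> ~~ bad_trial h (h i) (w.2 t) ->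
  s / 2 <= `|dotv (sketch N_gt0 w (t, (w.2 t).1 (h i))) x|.
Proof.
move=> iH /sketch_noise[le nocoll]; rewrite sketch_split //.
rewrite (bigD1 i) ?iH ?eqxx //= big1 ?addr0 => [|j]; last first.
  by move=> /andP[/andP[jH /eqP/(heavy_inj jH iH) ->]]; rewrite eqxx.
have := lerB_normD (sgn ((w.2 t).2 i) * x 0 i) (trial_noise h (h i) (w.2 t)).
rewrite norm_sgnM; have := heavy iH; have := s_gt0; lra.
Qed.

Lemma bad_trials_minority b : energy h b <= s ^+ 2 / 512 ->
  (2 * #|[pred t | bad_trial h b (w.2 t)]| < T)%N.
Proof.
move=> eb; have [_ _ _ /existsPn/(_ b) F _] := goodP.
by move: F; rewrite eb /= -ltnNge.
Qed.

(** The light energy totals at most [K * s ^+ 2], and each overloaded bucket takes more than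
    [s ^+ 2 / 512] of it. *)
Lemma card_overloaded : (#|[set b | (s ^+ 2 / 512 < energy h b)%R]| <= 512 * K)%N.
Proof.
rewrite -(ler_nat R) natrM.
have s2 : 0 < s ^+ 2 / 512 by rewrite divr_gt0 ?exprn_gt0 ?ltr0n.
rewrite -(ler_pM2r s2) -sum1_card natr_sum mulr_suml.
apply: (@le_trans _ _ (\sum_b energy h b)).
  rewrite big_mkcond /=; apply: ler_sum => b _; rewrite inE mul1r.
  by case: ltP => [/ltW//|_]; apply: sumr_ge0 => j _; rewrite sqr_ge0.
rewrite /energy -(partition_big h xpredT) //=; apply: le_trans light _.
by rewrite le_eqVlt; apply/orP; left; apply/eqP; field.
Qed.

(** Heavy buckets pass the threshold [s / 2], and its superlevel set fits the capacity: at most [K]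
    heavy and [512 * K] overloaded buckets. *)
Lemma heavy_selected (i : 'I_n) : (513 * K <= L)%N -> i \in H ->
  h i \in select L (majority w (fun p => dotv (sketch N_gt0 w p) x)).
Proof.
move=> KL iH; set D := majority w _.
suff DL : (#|D (s / 2)| <= L)%N.
  have antiD a b : a <= b -> D b \subset D a.
    move=> ab; apply/fintype.subsetP => c; rewrite !inE => /leq_trans; apply.
    rewrite leq_mul2l /=; apply/subset_leq_card/fintype.subsetP => t.
    by rewrite !inE; exact: le_trans.
  apply: (fintype.subsetP (sub_select antiD DL)); rewrite inE.
  have ei : energy h (h i) <= s ^+ 2 / 512.
    have [_ _ /existsPn/(_ i) + _ _] := goodP.
    by rewrite iH /= -leNgt.
  have := bad_trials_minority ei.
  set A := [pred t | bad_trial _ _ _]; set A' := [pred t | _].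
  have AA' : (T <= #|A| + #|A'|)%N.
    rewrite -{1}(card_ord T) -(cardC A) leq_add2l.
    apply/subset_leq_card/fintype.subsetP => t; rewrite !inE; exact: sketch_heavy.
  lia.
(* For a bucket neither heavy nor in [V], only bad trials can reach [s / 2], and they are a
   minority. *)
pose V := [set b | s ^+ 2 / 512 < energy h b].
have DV : D (s / 2) \subset [set h j | j in H] :|: V.
  apply/fintype.subsetP => b; rewrite finset.in_setU inE => Tb; apply/negPn/negP.
  rewrite negb_or inE -leNgt => /andP[bH /bad_trials_minority].
  set A := [pred t | bad_trial _ _ _] => badT; move: Tb; set A' := [pred t | _].
  have A'A : (#|A'| <= #|A|)%N.
    apply/subset_leq_card/fintype.subsetP => t; rewrite !inE leNgt.
    apply: contraNT => /sketch_light; apply => l lH.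
    by apply: contraNneq bH => <-; apply: imset_f.
  lia.
apply: leq_trans (subset_leq_card DV) _; apply: leq_trans (leq_card_setU _ _) _.
apply: leq_trans KL; rewrite mulSn leq_add //.
  exact: leq_trans (leq_imset_card _ _) card_H.
exact: card_overloaded.
Qed.

Lemma probe_noise_le (m : 'I_r) i c : i \in H -> `|probe_noise m i c w.1| <= s / 8.
Proof.
move=> iH; have [_ _ _ _ /existsPn/(_ m)/existsPn/(_ i)] := goodP.
rewrite iH /= => /existsPn/(_ c); rewrite -leNgt => le.
by apply: sqr_le_norm le; rewrite divr_ge0 // ltW.
Qed.

Lemma congr_heavy m i j : i \in H -> j \in H -> congr_mod m (g i) (g j) -> j = i.
Proof.
move=> iH jH /(congr_modW (leq0n m)); rewrite congr_mod0 => /eqP.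
exact: heavy_inj.
Qed.

(** Congruent codes share a bucket, so [i] is the only heavy coordinate of its class. *)
Lemma dotv_probe m i (u : 'I_n -> R) : i \in H ->
  \sum_(j | congr_mod m (g i) (g j)) u j =
  u i + \sum_(j | (j \notin H) && congr_mod m (g i) (g j)) u j.
Proof.
move=> iH; rewrite (bigID (mem H)) /= (bigD1 i) /=; last by rewrite iH /congr_mod eqxx.
rewrite big1 ?addr0 => [|j /andP[/andP[ij jH]]]; last first.
  by rewrite (congr_heavy iH jH ij) eqxx.
by congr (_ + _); apply: eq_bigl => j; rewrite andbC.
Qed.

(** The true digit leaves a residue of at most [s / 8], while [|u| > s / 2]. A wrong digit shifts
    the residue by at least [|u|], hence out of the window [|u| / 2]. *)
Lemma refine_congr (m : 'I_r) i (A : {set 'I_n}) : i \in H ->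
  A = [set j | congr_mod m (g i) (g j)] ->
  refine rad w m A (dotv (probe rad w m A false) x) (dotv (probe rad w m A true) x)
  = [set j | congr_mod m.+1 (g i) (g j)].
Proof.
move=> iH AE.
have dotE c : dotv (probe rad w m A c) x = \sum_(j | congr_mod m (g i) (g j))
    (if c then (digit M rad m (g j))%:R else 1) * sgn (w.1.2 j) * x 0 j.
  rewrite /dotv [RHS]big_mkcond; apply: eq_bigr => j _.
  by rewrite mxE AE inE; case: ifP => // _; rewrite mul0r.
set u := dotv (probe rad w m A false) x.
set v := dotv (probe rad w m A true) x.
have uE : u = sgn (w.1.2 i) * x 0 i + probe_noise m i false w.1.
  rewrite /u dotE (dotv_probe m _ iH) mul1r; congr (_ + _).
  by apply: eq_bigr => j _; rewrite /offset !mul1r.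
have vE : v - (digit M rad m (g i))%:R * u = probe_noise m i true w.1.
  rewrite /u /v !dotE mulr_sumr -sumrB (dotv_probe m _ iH).
  rewrite mul1r mulrA subrr add0r; apply: eq_bigr => j _.
  by rewrite /offset; ring.
have u_ge : s / 2 < `|u|.
  rewrite uE; have := lerB_normD (sgn (w.1.2 i) * x 0 i) (probe_noise m i false w.1).
  rewrite norm_sgnM; have := heavy iH; have := s_gt0.
  have := probe_noise_le m false iH; lra.
have v_le : `|v - (digit M rad m (g i))%:R * u| <= s / 8.
  by rewrite vE probe_noise_le.
apply/setP => j; rewrite !inE congr_modS AE inE; congr (_ && _).
have [->|ne] := eqVneq (digit M rad m (g j)) (digit M rad m (g i)).
  by have := s_gt0; lra.
apply/negbTE; rewrite -leNgt.
(* Over the integers a nonzero digit difference has absolute value at least 1. *)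
pose dl : int := (digit M rad m (g j))%:Z - (digit M rad m (g i))%:Z.
have : 1 <= `|dl%:~R : R|.
  rewrite -intr_norm (ler_int R 1) -gtz0_ge1 normr_gt0 subr_eq0.
  by apply: contraNneq ne => -[->].
have := lerB_dist (dl%:~R * u) (v - (digit M rad m (g i))%:R * u).
rewrite normrM.
have -> : dl%:~R * u - (v - (digit M rad m (g i))%:R * u) =
    - (v - (digit M rad m (g j))%:R * u) by rewrite rmorphB /= !pmulrn; ring.
rewrite normrN => le dl1; have : `|u| <= `|dl%:~R| * `|u| by rewrite ler_peMl.
have := s_gt0; lra.
Qed.

(** By induction with [refine_congr]; [heavy_selected] ensures that the bucket is really probed in
    each round. *)
Lemma candidates_congr m i : (513 * K <= L)%N -> i \in H -> (m <= r)%N ->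
  (stat w x m.+1).1.2 (h i) = [set j | congr_mod m (g i) (g j)].
Proof.
move=> KL iH; elim: m => [|m IH] mr.
  by rewrite state_round0 /=; apply/setP => j; rewrite !inE congr_mod0.
rewrite state_refine // ?(refine_congr (m := Ordinal mr) iH (IH (ltnW mr))) //.
by rewrite state_selected 1?ltnW // heavy_selected.
Qed.

(** At level [r] no other code is congruent to that of a heavy coordinate, so its class is a
    singleton. *)
Lemma heavy_resolved : (513 * K <= L)%N -> H \subset resolved (stat w x r.+1).
Proof.
move=> KL; apply/fintype.subsetP => i iH; rewrite inE; apply/existsP; exists (h i).
rewrite state_selected // heavy_selected // candidates_congr //=.
apply/eqP/setP => j; rewrite !inE; apply/idP/eqP => [ij|->]; last exact: eqxx.
apply/eqP/negPn/negP => ji.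
have [_ /existsPn/(_ i) + _ _ _] := goodP.
by rewrite iH /= => /existsPn/(_ j); rewrite ij eq_sym ji.
Qed.

End GoodSeed.

(** * Probabilities of the failure events *)

Local Notation codes := {ffun 'I_n -> 'I_(M r)}.

(** Division by [M m] is injective on a congruence class, with values below [M r %/ M m]. *)
Lemma card_congr m a : (m <= r)%N ->
  (#|[pred b : 'I_(M r) | congr_mod m a b]| * M m <= M r)%N.
Proof.
move=> /M_dvd mr; rewrite -leq_divRL ?M_gt0 //.
have quo_lt (b : 'I_(M r)) : (b %/ M m < M r %/ M m)%N.
  by rewrite ltn_divLR ?M_gt0 // divnK.
pose quo b := Ordinal (quo_lt b).
set A := [pred b | _].
have quo_inj : {in A &, injective quo}.
  move=> b c; rewrite !inE => /eqP eb /eqP ec [q].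
  by apply/val_inj; rewrite /= (divn_eq b (M m)) (divn_eq c (M m)) q eb ec.
by rewrite -(card_in_image quo_inj) (leq_trans (max_card _)) ?card_ord.
Qed.

Lemma Pr_congr m i j : (m <= r)%N -> i != j ->
  Pr codes (fun g => congr_mod m (g i) (g j)) <= (M m)%:R^-1 :> R.
Proof.
move=> mr ij; apply: (Pr_coll (rel := fun a b : 'I_(M r) => congr_mod m a b)) => //.
  exact: M_gt0.
by move=> a; rewrite card_ord card_congr.
Qed.

(** By linearity: a light [j] differs from [i], so it stays in the class with probability at most
    [1 / M m]. *)
Lemma residual_energy m i : (m <= r)%N -> i \in H ->
  Ex codes (fun g => \sum_(j | (j \notin H) && congr_mod m (g i) (g j)) x 0 j ^+ 2)
  <= K%:R * s ^+ 2 / (M m)%:R.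
Proof.
move=> mr iH.
rewrite (eq_Ex (g := fun g : codes => \sum_(j | j \notin H)
    x 0 j ^+ 2 * (congr_mod m (g i) (g j))%:R)); last first.
  move=> g; rewrite big_mkcondr; apply: eq_bigr => j _.
  by case: ifP; rewrite ?mulr1 ?mulr0.
rewrite Ex_sum; apply: (@le_trans _ _ (\sum_(j | j \notin H) x 0 j ^+ 2 / (M m)%:R)).
  apply: ler_sum => j jH; rewrite ExZl ler_wpM2l ?sqr_ge0 //.
  by apply: Pr_congr => //; apply: contraNneq jH => <-.
by rewrite -mulr_suml ler_wpM2r ?invr_ge0.
Qed.

Lemma Pr_heavy_collide :
  Pr codes heavy_collide <= K%:R * (K%:R * (M 0)%:R^-1) :> R.
Proof.
apply: Pr_exists_le => [||i iH]; rewrite ?mulr_ge0 ?invr_ge0 //.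
apply: Pr_exists_le => [||j /andP[_ ij]]; rewrite ?invr_ge0 ?Pr_congr //.
by apply: leq_trans card_H; apply/subset_leq_card/fintype.subsetP => j /andP[].
Qed.

Lemma Pr_code_collide :
  Pr codes code_collide <= K%:R * (n%:R * (M r)%:R^-1) :> R.
Proof.
apply: Pr_exists_le => [||i iH]; rewrite ?mulr_ge0 ?invr_ge0 //.
apply: Pr_exists_le => [||j ij]; rewrite ?invr_ge0 ?Pr_congr //.
by apply: leq_trans (max_card _) _; rewrite card_ord.
Qed.

Lemma Pr_bucket_overload :
  Pr codes bucket_overload <= K%:R * (512 * (K%:R / (M 0)%:R)) :> R.
Proof.
apply: Pr_exists_le => [||i iH]; rewrite ?mulr_ge0 ?invr_ge0 ?ler0n //.
apply: markov_le => [|g|]; rewrite ?divr_gt0 ?exprn_gt0 ?ltr0n //.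
  by apply: sumr_ge0 => j _; rewrite sqr_ge0.
have := residual_energy (leq0n r) iH; rewrite /energy.
under eq_Ex do under eq_bigl do rewrite congr_mod0.
move=> le; apply: le_trans le _; rewrite le_eqVlt; apply/orP; left; apply/eqP.
by field; rewrite pnatr_eq0 -lt0n M_gt0.
Qed.

(** Heavy collisions cost [1/1024] and the noise, by Markov, [16 * (1/512 + 1/1024)]; together
    [49/1024 < 1/15]. *)
Lemma Pr_bad_trial (h : 'I_n -> 'I_N) b :
  (1024 * K <= B)%N -> (0 < B)%N -> energy h b <= s ^+ 2 / 512 ->
  Pr trial (bad_trial h b) <= 15^-1 :> R.
Proof.
move=> KB B0 eb; apply: le_trans (PrU _ _) _.
have BR : 0 < B%:R :> R by rewrite ltr0n.
have KBR : K%:R / B%:R <= 1024^-1 :> R.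
  by rewrite ler_pdivrMr // mulrC ler_pdivlMr ?ltr0n // mulrC -natrM ler_nat.
have hash c : c != b ->
    Pr {ffun 'I_N -> 'I_B} (fun f => f c == f b) <= B%:R^-1 :> R.
  move=> cb; apply: (Pr_coll (rel := fun a d : 'I_B => a == d)) => // a.
  rewrite card_ord -[X in (_ <= X)%N]mul1n leq_mul2r; apply/orP; right.
  by rewrite -(card1 a); apply/subset_leq_card/fintype.subsetP => d; rewrite !inE eq_sym.
have coll : Pr trial (fun p => [exists (i | (i \in H) && (h i != b)),
    p.1 (h i) == p.1 b]) <= K%:R * B%:R^-1 :> R.
  apply: Pr_exists_le => [||i /andP[_ ib]]; rewrite ?invr_ge0 //.
    by apply: leq_trans card_H; apply/subset_leq_card/fintype.subsetP => j /andP[].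
  exact: le_trans (Pr_fst (fun f : {ffun 'I_N -> 'I_B} => f (h i) == f b)) (hash _ ib).
have noise : Pr trial (fun p => (s / 4) ^+ 2 < trial_noise h b p ^+ 2)
    <= 16 * (512^-1 + K%:R / B%:R) :> R.
  apply: (markov_le (f := fun p => trial_noise h b p ^+ 2)) => [|p|];
    rewrite ?sqr_ge0 ?exprn_gt0 ?divr_gt0 ?ltr0n //.
  rewrite Ex_prod /trial_noise /=; under eq_Ex do rewrite Ex_sgn_sq.
  rewrite (eq_Ex (g := fun f : {ffun 'I_N -> 'I_B} => \sum_(j | j \notin H)
      x 0 j ^+ 2 * (f (h j) == f b)%:R)); last first.
    move=> g; rewrite big_mkcondr; apply: eq_bigr => j _.
    by case: ifP; rewrite ?mulr1 ?mulr0.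
  (* Light coordinates of [b] itself cost at most its energy; those of other buckets enter its cell
     with probability at most [1 / B]. *)
  rewrite Ex_sum (bigID (fun j => h j == b)) /=.
  apply: (@le_trans _ _ (s ^+ 2 / 512 + K%:R * s ^+ 2 / B%:R)); last first.
    by rewrite le_eqVlt; apply/orP; left; apply/eqP; field; rewrite gt_eqF.
  apply: lerD.
    apply: le_trans eb; apply: ler_sum => j _.
    rewrite ExZl -[leRHS]mulr1 ler_wpM2l ?sqr_ge0 //; exact: Pr_le1.
  apply: (@le_trans _ _ (\sum_(j | j \notin H) x 0 j ^+ 2 / B%:R)); last first.
    by rewrite -mulr_suml ler_wpM2r ?invr_ge0 // ltW.
  rewrite big_mkcondr; apply: ler_sum => j _; case: ifP => jb.
    by rewrite ExZl ler_wpM2l ?sqr_ge0 // hash ?jb.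
  by rewrite divr_ge0 ?sqr_ge0 ?ltW.
apply: le_trans (lerD coll noise) _; move: KBR; lra.
Qed.

(** Once the codes are fixed, so are the energies, and the trials are independent: [Pr_majority] and
    a union bound over the [N] buckets. *)
Lemma Pr_sketch_fail : (1024 * K <= B)%N -> (0 < B)%N ->
  Pr (seeds n N B T r M) sketch_fail <= N%:R * 2^-1 ^+ T :> R.
Proof.
move=> KB B0; rewrite Pr_prod; apply: Ex_le_cst => [|p].
  by rewrite mulr_ge0 ?exprn_ge0 ?invr_ge0 ?ler0n.
apply: (Pr_exists_le (P := xpredT)) => [||b _].
- by rewrite (leq_trans (max_card _)) ?card_ord.
- by rewrite exprn_ge0 ?invr_ge0 ?ler0n.
have [eb|_] := boolP (energy (fun j => bucket (p.1 j)) b <= s ^+ 2 / 512).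
  rewrite /=; apply: Pr_majority; first exact: Pr_bad_trial.
  by rewrite card_prod !card_ffun !card_ord card_bool muln_gt0 !expn_gt0 B0.
by rewrite Pr_set0 // exprn_ge0 ?invr_ge0 ?ler0n.
Qed.

Lemma offset_sq m c a b : offset m c a b ^+ 2 <= (rad m)%:R ^+ 2.
Proof.
rewrite -[leLHS]real_normK ?num_real // lerXn2r ?nnegrE ?normr_ge0 ?ler0n //.
rewrite /offset; case: c; last by rewrite normr1 ler1n.
have da e : (digit M rad m e)%:R <= (rad m)%:R :> R.
  by rewrite ler_nat ltnW // ltn_mod.
have d0 e : 0 <= (digit M rad m e)%:R :> R by [].
by have := (da a, da b, d0 a, d0 b) => -[[[? ?] ?] ?]; rewrite ler_norml; lra.
Qed.

(** Averaging over the signs leaves the residual energy weighted by squared offsets, each at most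
    the squared radix; then Markov. *)
Lemma Pr_probe_noise m i c : (m <= r)%N -> i \in H ->
  Pr (codes * {ffun 'I_n -> bool})%type
    (fun p => (s / 8) ^+ 2 < probe_noise m i c p ^+ 2)
  <= 64 * (K%:R * ((rad m)%:R ^+ 2 / (M m)%:R)) :> R.
Proof.
move=> mr iH; apply: (markov_le (f := fun p => probe_noise m i c p ^+ 2)) => [|p|];
  rewrite ?sqr_ge0 ?exprn_gt0 ?divr_gt0 ?ltr0n //.
rewrite Ex_prod /probe_noise /=; under eq_Ex do rewrite Ex_sgn_sq.
apply: (@le_trans _ _ (Ex codes (fun g => (rad m)%:R ^+ 2 *
   \sum_(j | (j \notin H) && congr_mod m (g i) (g j)) x 0 j ^+ 2))).
  apply: ler_Ex => g; rewrite mulr_sumr; apply: ler_sum => j _.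
  by rewrite exprMn ler_wpM2r ?sqr_ge0 // offset_sq.
rewrite ExZl; apply: (@le_trans _ _ ((rad m)%:R ^+ 2 * (K%:R * s ^+ 2 / (M m)%:R))).
  by rewrite ler_wpM2l ?sqr_ge0 // residual_energy.
by rewrite le_eqVlt; apply/orP; left; apply/eqP; field; rewrite pnatr_eq0 -lt0n M_gt0.
Qed.

Lemma Pr_probe_fail :
  Pr (codes * {ffun 'I_n -> bool})%type probe_fail
  <= 128 * K%:R ^+ 2 * \sum_(m < r) (rad m)%:R ^+ 2 / (M m)%:R :> R.
Proof.
apply: le_trans (Pr_exists xpredT (fun (m : 'I_r) p => [exists (i | i \in H),
  exists c, (s / 8) ^+ 2 < probe_noise m i c p ^+ 2])) _.
rewrite mulr_sumr; apply: ler_sum => m _.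
apply: (@le_trans _ _ (K%:R * (2 * (64 * (K%:R * ((rad m)%:R ^+ 2 / (M m)%:R)))))).
  have p0 : 0 <= 64 * (K%:R * ((rad m)%:R ^+ 2 / (M m)%:R)) :> R.
    by rewrite mulr_ge0 ?ler0n // mulr_ge0 // divr_ge0 ?sqr_ge0.
  apply: Pr_exists_le => [||i iH]; rewrite ?mulr_ge0 ?ler0n //.
  apply: (Pr_exists_le (P := xpredT)) => [||c _] //.
    by rewrite (leq_trans (max_card _)) ?card_bool.
  by apply: Pr_probe_noise => //; exact: ltnW.
by rewrite le_eqVlt; apply/orP; left; apply/eqP; ring.
Qed.

(** The factor [513 = 1 + 512] merges heavy collisions with bucket overloads. *)
Lemma Pr_fail : (1024 * K <= B)%N -> (0 < B)%N ->
  Pr (seeds n N B T r M) fail <=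
    513 * K%:R ^+ 2 / N%:R + K%:R * n%:R / (M r)%:R + N%:R * 2^-1 ^+ T +
    128 * K%:R ^+ 2 * \sum_(m < r) (rad m)%:R ^+ 2 / (M m)%:R :> R.
Proof.
move=> KB B0.
have lift_code (A : pred codes) (p : R) : Pr codes A <= p ->
    Pr (seeds n N B T r M) (fun w => A w.1.1) <= p.
  move=> le; apply: le_trans le; apply: le_trans (Pr_fst A).
  exact: (Pr_fst (fun v : codes * {ffun 'I_n -> bool} => A v.1)).
have p5 := le_trans (Pr_fst (W := {ffun 'I_T -> trial}) probe_fail) Pr_probe_fail.
have p1 := lift_code _ _ Pr_heavy_collide.
have p2 := lift_code _ _ Pr_code_collide.
have p3 := lift_code _ _ Pr_bucket_overload.
apply: le_trans (PrU _ _) _; apply: le_trans (lerD p1 (PrU _ _)) _.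
apply: le_trans (lerD (lexx _) (lerD p2 (PrU _ _))) _.
apply: le_trans (lerD (lexx _) (lerD (lexx _) (lerD p3 (PrU _ _)))) _.
have p4 := Pr_sketch_fail KB B0.
apply: le_trans (lerD (lexx _) (lerD (lexx _) (lerD (lexx _) (lerD p4 p5)))) _.
rewrite M0 le_eqVlt; apply/orP; left; apply/eqP; ring.
Qed.

End Correctness.

(** * Realizing the uniform seed on a probability space *)

Section UniformOnNat.
Context {R : realType}.

Lemma invS_ge0 (m : nat) : 0 <= m.+1%:R^-1 :> R.
Proof. by rewrite invr_ge0. Qed.

(** Every subset of [nat] is measurable, which makes success events measurable at once. *)
Definition uniform_nat (m : nat) : set nat -> \bar R :=
  mscale (NngNum (invS_ge0 m)) (msum (fun i => dirac i) m.+1).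

HB.instance Definition _ (m : nat) := Measure.on (uniform_nat m).

Lemma uniform_natE m (A : set nat) :
  uniform_nat m A = ((\sum_(i < m.+1) (val i \in A)%:R) / m.+1%:R)%:E.
Proof.
rewrite /uniform_nat /mscale /msum /= mulrC EFinM; congr (_ * _)%E.
by rewrite -sumEFin; apply: eq_bigr => i _; exact: diracE.
Qed.

Lemma uniform_nat_setT m : uniform_nat m setT = 1%E.
Proof.
rewrite uniform_natE (eq_bigr (fun=> 1)) => [|i _]; last by rewrite in_setT.
by rewrite sumr_const card_ord divff // pnatr_eq0.
Qed.

HB.instance Definition _ (m : nat) :=
  @Measure_isProbability.Build _ _ R (uniform_nat m) (uniform_nat_setT m).

Lemma uniform_seed (W : finType) : (0 < #|W|)%N ->
  exists (seed : nat -> W) (P : probability nat R),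
    forall A : pred W, P [set i | A (seed i)]%classic = (Pr W A)%:E.
Proof.
move=> W0; have [m Wm] : exists m, #|W| = m.+1 by exists #|W|.-1; rewrite prednK.
(* [inord] makes the enumeration of [W] total on [nat]; it is bijective on the first [m.+1]
   integers, which carry all the mass. *)
pose seed i := enum_val (cast_ord (esym Wm) (inord i)).
exists seed, (uniform_nat m) => A; rewrite [LHS]uniform_natE /Pr /Ex Wm.
congr ((_ / _)%:E).
rewrite (reindex (fun i : 'I_m.+1 => seed i)) /=; last first.
  exists (fun a => cast_ord Wm (enum_rank a)) => [i|a] _.
    by rewrite /seed enum_valK cast_ordKV inord_val.
  by rewrite /seed inord_val cast_ordK enum_rankK.
apply: eq_bigr => i _; congr ((_ : bool)%:R).
by apply/idP/idP => [|Ai]; rewrite ?inE //; exact/mem_set.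
Qed.

End UniformOnNat.

Lemma Pr_setC {R : realFieldType} {W : finType} (A : pred W) : (0 < #|W|)%N ->
  Pr W (fun w => ~~ A w) = 1 - Pr W A :> R.
Proof.
move=> W0; apply/eqP; rewrite eq_sym subr_eq -ExD -[eqbLHS](Ex_cst _ W0); apply/eqP.
by apply: eq_Ex => w; case: (A w); rewrite ?addr0 ?add0r.
Qed.

(** * Heavy coordinates and the energy of the rest *)

Section HeavyTail.
Context {R : realType}.
Variables (n k : nat) (x : 'rV[R]_n).
Hypothesis k_gt0 : (0 < k)%N.

Definition tail_level : R := k%:R^-1 * norm2_sq (tail_vec k x).

Definition heavy_set : {set 'I_n} := [set i | tail_level < x 0 i ^+ 2].

Lemma card_top_set : (#|top_set k x| <= k)%N.
Proof.
rewrite /top_set; case: pickP => [S /andP[/eqP -> _]|_] /=.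
  exact: geq_minl.
by rewrite cards0.
Qed.

Lemma tail_energy : \sum_(j | j \notin top_set k x) x 0 j ^+ 2 = k%:R * tail_level.
Proof.
rewrite /tail_level mulrA divff ?pnatr_eq0 -?lt0n // mul1r /norm2_sq big_mkcond.
by apply: eq_bigr => j _; rewrite mxE; case: (_ \in _) => //=; rewrite expr0n.
Qed.

Lemma tail_level_ge0 : 0 <= tail_level.
Proof. by rewrite mulr_ge0 ?invr_ge0 // sumr_ge0 // => i _; rewrite sqr_ge0. Qed.

(** At most [k] lie in the top set; outside it each exceeds [tail_level] in a sum equal to
    [k * tail_level], so again at most [k]. *)
Lemma card_heavy_set : (#|heavy_set| <= 2 * k)%N.
Proof.
rewrite -(cardsID (top_set k x)) mul2n -addnn leq_add //.
  exact: leq_trans (subset_leq_card (subsetIr _ _)) card_top_set.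
rewrite leqNgt; apply/negP; set D := _ :\: _ => kD.
have [j jD] : exists j, j \in D by apply/set0Pn; rewrite -card_gt0 (leq_trans _ kD).
have DE i : i \in D -> (i \notin top_set k x) && (tail_level < x 0 i ^+ 2).
  by rewrite !inE.
have : \sum_(i in D) tail_level < k%:R * tail_level.
  rewrite -tail_energy; apply: (@lt_le_trans _ _ (\sum_(i in D) x 0 i ^+ 2)).
    apply: ltr_sum => [|i /DE/andP[] //].
    by apply/hasP; exists j; rewrite ?mem_index_enum.
  rewrite [leLHS]big_mkcond [leRHS]big_mkcond; apply: ler_sum => i _.
  by case: ifP => [/DE/andP[-> _] //|_]; case: ifP => // _; rewrite sqr_ge0.
rewrite sumr_const -[_ *+ _]mulr_natl ltNge ler_wpM2r ?tail_level_ge0 //.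
by rewrite ler_nat ltnW.
Qed.

(** Light coordinates of the top set are at most [k], each of square at most [tail_level]; the
    others are part of the tail. *)
Lemma light_energy :
  \sum_(j | j \notin heavy_set) x 0 j ^+ 2 <= (2 * k)%:R * tail_level.
Proof.
rewrite (bigID (mem (top_set k x))) /= mul2n -addnn natrD mulrDl lerD //.
  apply: (@le_trans _ _ (\sum_(j in top_set k x) tail_level)).
    rewrite big_mkcondl /=; apply: ler_sum => j _.
    by rewrite inE -leNgt; case: ifP => // _; exact: tail_level_ge0.
  rewrite sumr_const -[_ *+ _]mulr_natl ler_wpM2r ?tail_level_ge0 //.
  by rewrite ler_nat card_top_set.
rewrite -tail_energy [leLHS]big_mkcond [leRHS]big_mkcond; apply: ler_sum => j _.
by case: (j \in top_set k x); rewrite ?andbF //= andbT; case: ifP => // _; rewrite sqr_ge0.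
Qed.

(* A strictly positive scale separating heavy from light, even if the tail is 0. *)
Lemma heavy_scale : exists s : R, [/\ 0 < s, tail_level <= s ^+ 2 &
  forall i, i \in heavy_set -> s <= `|x 0 i|].
Proof.
(* The default [tail_level + 1] keeps [a] above [tail_level] when there is no heavy coordinate. *)
pose a := \big[Num.min/(tail_level + 1)]_(i in heavy_set) x 0 i ^+ 2.
have ta : tail_level < a.
  by apply: lt_bigmin => [|i]; [rewrite ltrDl | rewrite inE].
have a0 : 0 < a := le_lt_trans tail_level_ge0 ta.
exists (Num.sqrt a); split; first by rewrite sqrtr_gt0.
  by rewrite sqr_sqrtr ltW.
move=> i iH; rewrite -sqrtr_sqr ler_wsqrtr //.
exact: bigmin_le_cond.
Qed.

End HeavyTail.

(** * Choice of the parameters and the total failure probability *)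

Section Sizes.
Variables (n k : nat).

Definition level : nat := (trunc_log 2 k).+1.
Definition sparsity : nat := 2 ^ level.+1.
(** Solves [128 * sparsity ^ 2 * 2 ^ (level + 3) = 2 ^ base_exp]. *)
Definition base_exp : nat := 3 * level + 12.
Definition radix (m : nat) : nat := 2 ^ (base_exp * 2 ^ (m %/ 4)).
(** Closed form of the running product of radices, from [2 ^ (4 * base_exp)]: within a block the
    factor runs from 4 to 7, and the next value 8 is 4 with a doubled power. *)
Definition modulus (m : nat) : nat := 2 ^ (base_exp * ((4 + m %% 4) * 2 ^ (m %/ 4))).
Definition depth : nat := up_log 2 (up_log 2 n).
(** [4 * base_exp] pays for the union bound over buckets; [level + 3] is the margin left. *)
Definition trials : nat := 4 * base_exp + level + 3.

Lemma modulusS m : modulus m.+1 = (modulus m * radix m)%N.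
Proof.
rewrite /modulus /radix -expnD -mulnDr; congr (2 ^ (_ * _))%N.
have [[-> ->]|[-> [-> ->]]] :
    (m.+1 %/ 4 = m %/ 4)%N /\ (m.+1 %% 4 = (m %% 4).+1)%N \/
    (m.+1 %/ 4 = (m %/ 4).+1)%N /\ (m.+1 %% 4 = 0)%N /\ (m %% 4 = 3)%N by lia.
  by rewrite addnS mulSn addnC.
by rewrite addn0 expnS; lia.
Qed.

Lemma radix_gt0 m : (0 < radix m)%N. Proof. by rewrite expn_gt0. Qed.
Lemma modulus_gt0 m : (0 < modulus m)%N. Proof. by rewrite expn_gt0. Qed.

(** The modulus is at least the fourth power of the radix. Two powers pay for squared offsets, two
    for [2 ^ base_exp] and a factor making the failures summable over rounds. *)
Lemma radix_modulus m : (radix m ^ 2 * (2 ^ base_exp * 2 ^ m.+1) <= modulus m)%N.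
Proof.
rewrite /radix /modulus -expnM -!expnD leq_exp2l //.
have q_lt := ltn_expl (m %/ 4) (isT : 1 < 2)%N; set p := (2 ^ (m %/ 4))%N in q_lt *.
have : (m.+1 <= 4 * p)%N by lia.
have : (12 <= base_exp)%N by rewrite leq_addl.
set e := base_exp; nia.
Qed.

Lemma lt_level : (k < 2 ^ level)%N.
Proof. exact: trunc_log_ltn. Qed.

Lemma sparsity_ge : (2 * k <= sparsity)%N.
Proof. by rewrite /sparsity expnS leq_mul2l ltnW ?lt_level. Qed.

Lemma sparsity_le : (0 < k)%N -> (sparsity <= 4 * k)%N.
Proof.
move=> k0; rewrite /sparsity /level !expnS mulnA leq_mul2l /=.
exact: trunc_logP.
Qed.

Lemma le_depth : (n <= 2 ^ 2 ^ depth)%N.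
Proof.
apply: leq_trans (up_logP n (isT : 1 < 2)%N) _.
by rewrite leq_exp2l // up_logP.
Qed.

Lemma ler_frac {R : realFieldType} (a b c : nat) : (0 < b)%N -> (0 < c)%N ->
  (a * c <= b)%N -> a%:R / b%:R <= c%:R^-1 :> R.
Proof.
move=> b0 c0 abc; rewrite ler_pdivrMr ?ltr0n // mulrC ler_pdivlMr ?ltr0n //.
by rewrite -natrM ler_nat.
Qed.

Lemma sum_geometric_le {R : realFieldType} (r : nat) :
  \sum_(m < r) 2^-1 ^+ m.+1 <= 1 :> R.
Proof.
have -> : \sum_(m < r) 2^-1 ^+ m.+1 = 1 - 2^-1 ^+ r :> R.
  elim: r => [|r IH]; first by rewrite big_ord0 expr0 subrr.
  by rewrite big_ord_recr /= IH exprS; lra.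
by rewrite lerBlDr lerDl exprn_ge0 ?invr_ge0 ?ler0n.
Qed.

Lemma failure_sum {R : realFieldType} : (0 < k)%N ->
  513 * sparsity%:R ^+ 2 / (modulus 0)%:R +
  sparsity%:R * n%:R / (modulus (4 * depth))%:R +
  (modulus 0)%:R * 2^-1 ^+ trials +
  128 * sparsity%:R ^+ 2 *
    \sum_(m < 4 * depth) (radix m)%:R ^+ 2 / (modulus m)%:R <= k%:R^-1 :> R.
Proof.
(* Each of the four terms is allowed [eps]; four of them stay below [1 / k] because
   [k < 2 ^ level]. *)
move=> k0; pose eps : R := (2 ^ (level + 3))%:R^-1.
have N0 : modulus 0 = (2 ^ (4 * base_exp))%N.
  by rewrite /modulus div0n mod0n addn0 expn0 muln1 mulnC.
have t1 : 513 * sparsity%:R ^+ 2 / (modulus 0)%:R <= eps.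
  rewrite -natrX -natrM ler_frac ?modulus_gt0 ?expn_gt0 // N0 /sparsity.
  apply: (@leq_trans (2 ^ 10 * (2 ^ level.+1) ^ 2 * 2 ^ (level + 3)))%N.
    by rewrite !leq_mul2r; apply/orP; right; apply/orP; right.
  by rewrite -expnM -!expnD leq_exp2l // /base_exp; lia.
(* The final modulus is [2 ^ (4 * base_exp * 2 ^ depth)], and [2 ^ 2 ^ depth] is already at least
   [n]. *)
have t2 : sparsity%:R * n%:R / (modulus (4 * depth))%:R <= eps.
  rewrite -natrM ler_frac ?modulus_gt0 ?expn_gt0 //.
  apply: (@leq_trans (2 ^ level.+1 * 2 ^ 2 ^ depth * 2 ^ (level + 3)))%N.
    by rewrite leq_mul2r leq_mul2l le_depth !orbT.
  rewrite /modulus mulKn // modnMr addn0 -!expnD leq_exp2l // /base_exp.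
  have : (0 < 2 ^ depth)%N by rewrite expn_gt0.
  move: (2 ^ depth)%N => p; nia.
have t3 : (modulus 0)%:R * 2^-1 ^+ trials <= eps.
  rewrite N0 /trials -addnA exprD exprVn -natrX mulrA divff ?mul1r; last first.
    by rewrite pnatr_eq0 -lt0n expn_gt0.
  by rewrite exprVn -natrX.
have t4 : 128 * sparsity%:R ^+ 2 *
    \sum_(m < 4 * depth) (radix m)%:R ^+ 2 / (modulus m)%:R <= eps.
  have S : \sum_(m < 4 * depth) (radix m)%:R ^+ 2 / (modulus m)%:R
      <= (2 ^ base_exp)%:R^-1 :> R.
    rewrite -[leRHS]mulr1; apply: (@le_trans _ _ (\sum_(m < 4 * depth)
        (2 ^ base_exp)%:R^-1 * 2^-1 ^+ m.+1)); last first.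
      by rewrite -mulr_sumr ler_wpM2l ?invr_ge0 // sum_geometric_le.
    apply: ler_sum => m _; rewrite exprVn -!natrX -invfM -natrM.
    by rewrite ler_frac ?modulus_gt0 ?muln_gt0 ?expn_gt0 ?radix_modulus.
  apply: (@le_trans _ _ (128 * sparsity%:R ^+ 2 / (2 ^ base_exp)%:R)).
    by rewrite ler_wpM2l // mulr_ge0 ?exprn_ge0 ?ler0n.
  rewrite -natrX -natrM ler_frac ?expn_gt0 // /sparsity -expnM.
  rewrite (_ : 128 = 2 ^ 7)%N // -!expnD leq_exp2l // /base_exp; lia.
have : 4 * eps <= k%:R^-1.
  rewrite /eps ler_frac ?expn_gt0 // addnC expnD.
  by have := lt_level; lia.
lra.
Qed.

End Sizes.

(** * Comparison of integer logarithms with [Log] *)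

Section Logarithms.
Context {R : realType}.

Lemma inv_ln2_gt0 : 0 < (ln 2 : R)^-1.
Proof. by rewrite invr_gt0 ln_gt0 // ltr1n. Qed.

Lemma Log_ge1 (t : R) : 1 <= Log t.
Proof. by rewrite /Log le_max lexx. Qed.

Lemma ln_le_Log (t : R) : ln t <= Log t.
Proof. by rewrite /Log le_max lexx orbT. Qed.

Lemma log2_le_ln (t : nat) (y : R) : 2 ^+ t <= y -> t%:R <= (ln 2)^-1 * ln y.
Proof.
move=> ty; rewrite mulrC ler_pdivlMr ?ln_gt0 ?ltr1n //.
rewrite mulr_natl -lnXn ?ltr0n // ler_ln ?posrE ?exprn_gt0 ?ltr0n //.
by apply: lt_le_trans ty; rewrite exprn_gt0 ?ltr0n.
Qed.

Lemma trunc_log_le_Log (k : nat) : (0 < k)%N ->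
  (trunc_log 2 k)%:R <= (ln 2)^-1 * Log (k%:R : R).
Proof.
move=> k0; apply: (@le_trans _ _ ((ln 2)^-1 * ln k%:R)).
  by apply: log2_le_ln; rewrite -natrX ler_nat trunc_logP.
by rewrite ler_wpM2l ?(ltW inv_ln2_gt0) ?ln_le_Log.
Qed.

(** Rounding up costs 1, absorbed because [Log] is at least 1. *)
Lemma up_log_le_Log (n : nat) :
  (up_log 2 n)%:R <= (1 + (ln 2)^-1) * Log (n%:R : R).
Proof.
have c0 := inv_ln2_gt0; have L1 := Log_ge1 (n%:R : R).
have [n1|n1] := leqP n 1.
  have -> : up_log 2 n = 0%N by apply/eqP; rewrite up_log_eq0 n1.
  by rewrite mulr_ge0 ?addr_ge0 ?ler01 ?(ltW c0) ?(le_trans ler01 L1).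
have u0 : (0 < up_log 2 n)%N by rewrite up_log_gt0.
have le : (up_log 2 n).-1%:R <= (ln 2)^-1 * ln (n%:R : R).
  by apply: log2_le_ln; rewrite -natrX ler_nat ltnW // up_log_gtn.
have le' := ler_wpM2l (ltW c0) (ln_le_Log (n%:R : R)).
rewrite -(prednK u0) -natr1 mulrDl mul1r; lra.
Qed.

(** Take [ln] of [up_log_le_Log]: its constant adds [ln (1 + a) <= a] with [a = (ln 2)^-1], whence
    the square, and rounding up adds 1. *)
Lemma depth_le_Log (n : nat) : (depth n)%:R <=
  (1 + (ln 2)^-1 + (ln 2)^-1 ^+ 2) * Log (Log (n%:R : R)).
Proof.
have c0 := inv_ln2_gt0; have L1 := Log_ge1 (Log (n%:R : R)).
have Ln1 := Log_ge1 (n%:R : R).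
rewrite /depth; have [u1|u1] := leqP (up_log 2 n) 1.
  have -> : up_log 2 (up_log 2 n) = 0%N by apply/eqP; rewrite up_log_eq0 u1.
  by rewrite mulr_ge0 ?addr_ge0 ?exprn_ge0 ?ler01 ?(ltW c0) ?(le_trans ler01 L1).
have d0 : (0 < up_log 2 (up_log 2 n))%N by rewrite up_log_gt0.
set d := up_log 2 (up_log 2 n) in d0 *.
have le : d.-1%:R <= (ln 2)^-1 * ln ((1 + (ln 2)^-1) * Log (n%:R : R)).
  apply: log2_le_ln; apply: le_trans (up_log_le_Log n).
  by rewrite -natrX ler_nat ltnW // up_log_gtn.
have c1 : 0 < 1 + (ln 2 : R)^-1 by rewrite addr_gt0.
have lnle : ln ((1 + (ln 2)^-1) * Log (n%:R : R)) <= (ln 2)^-1 + Log (Log (n%:R : R)).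
  rewrite lnM ?posrE ?(lt_le_trans ltr01 Ln1) // lerD ?ln_le_Log //.
  by apply: le_ln1Dx; apply: lt_trans c0; rewrite ltrN10.
have le' := ler_wpM2l (ltW c0) lnle.
have sq : (ln 2)^-1 ^+ 2 <= (ln 2)^-1 ^+ 2 * Log (Log (n%:R : R)).
  by rewrite ler_peMr // exprn_ge0 // ltW.
rewrite -(prednK d0) -natr1 expr2 in sq *; lra.
Qed.

End Logarithms.

(** * Instantiation of the algorithm and the final bounds *)

Section Assembly.
Context {R : realType}.

Local Notation cells k := (1024 * sparsity k)%N.
Local Notation capacity k := (513 * sparsity k)%N.

Definition full_recovery (n k : nat) {Om : Type} :=
  @recovery R n (modulus k 0) (cells k) (trials k) (capacity k) (4 * depth n)
    (modulus k) (radix k) (modulus_gt0 k 0) Om.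

Local Notation all_seeds n k :=
  (seeds n (modulus k 0) (cells k) (trials k) (4 * depth n) (modulus k)).

Definition full_fail n k (x : 'rV[R]_n) (s : R) (w : all_seeds n k) : bool :=
  fail (radix k) (modulus_gt0 k 0) x (heavy_set k x) s w.

(** Resolved coordinates are read exactly; an unresolved one is estimated by 0 and is light, so its
    square is at most [tail_level]. *)
Lemma full_recovery_error n k {Om : Type} (seed : Om -> all_seeds n k)
    (x : 'rV[R]_n) (s : R) w : (0 < k)%N -> 0 < s -> tail_level k x <= s ^+ 2 ->
  (forall i, i \in heavy_set k x -> s <= `|x 0 i|) ->
  ~~ full_fail x s (seed w) ->
  norm_inf (x - run (full_recovery seed) w x) ^+ 2 <= tail_level k x.
Proof.
move=> k0 s0 ts hs good; rewrite recovery_run.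
have HK := leq_trans (card_heavy_set x k0) (sparsity_ge k).
have lightK : \sum_(j | j \notin heavy_set k x) x 0 j ^+ 2 <= (sparsity k)%:R * s ^+ 2.
  apply: le_trans (light_energy x k0) _.
  by rewrite ler_pM ?ler_nat ?sparsity_ge ?tail_level_ge0.
have /fintype.subsetP sub := heavy_resolved (erefl _) (modulusS k) (radix_gt0 k)
  s0 HK hs lightK good (leqnn _).
rewrite -[leRHS]sqr_sqrtr ?tail_level_ge0 // lerXn2r ?nnegrE ?sqrtr_ge0 //.
  by rewrite /norm_inf; elim/big_ind: _ => // a b a0 b0; rewrite le_max a0.
rewrite /norm_inf; apply: bigmax_le => [|i _]; first exact: sqrtr_ge0.
rewrite !mxE; case: ifP => [_|/negbT ni]; first by rewrite subrr normr0 sqrtr_ge0.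
rewrite subr0 -sqrtr_sqr ler_wsqrtr // leNgt.
by apply: contra ni => xi; apply: sub; rewrite inE.
Qed.

Lemma full_recovery_fail n k (x : 'rV[R]_n) (s : R) :
  (0 < k)%N -> 0 < s -> tail_level k x <= s ^+ 2 ->
  Pr (all_seeds n k) (full_fail x s) <= k%:R^-1 :> R.
Proof.
move=> k0 s0 ts; apply: le_trans (failure_sum n k0).
apply: Pr_fail => //.
- exact: modulusS.
- exact: radix_gt0.
- exact: leq_trans (card_heavy_set x k0) (sparsity_ge k).
- apply: le_trans (light_energy x k0) _.
  by rewrite ler_pM ?ler_nat ?sparsity_ge ?tail_level_ge0.
- by rewrite muln_gt0 expn_gt0.
Qed.

Lemma card_seeds n N B T r M : (0 < B)%N -> (0 < M r)%N ->
  (0 < #|{: seeds n N B T r M}|)%N.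
Proof.
move=> B0 M0; rewrite !card_prod !card_ffun !card_prod !card_ffun !card_ord card_bool.
by rewrite !(muln_gt0, expn_gt0) B0 M0.
Qed.

Lemma card_all_seeds n k : (0 < #|{: all_seeds n k}|)%N.
Proof. by rewrite card_seeds ?modulus_gt0 // muln_gt0 expn_gt0. Qed.

Lemma measurement_total (t d p k : nat) : (p <= 4 * k)%N ->
  (t * (1024 * p) + 4 * d * (2 * (513 * p)) + 513 * p)%N%:R <=
  t%:R * 4096 * k%:R + (8 * d%:R + 1) * 2052 * k%:R :> R.
Proof.
rewrite -(ler_nat R) 2!natrD 7!natrM => pk.
have tp := ler_wpM2l (ler0n R t) pk; have dp := ler_wpM2l (ler0n R d) pk; lra.
Qed.

Lemma log_constant : exists2 c : R, 0 < c &
  (forall k : nat, (0 < k)%N -> (trunc_log 2 k)%:R <= c * Log (k%:R : R)) /\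
  (forall n : nat, (depth n)%:R <= c * Log (Log (n%:R : R))).
Proof.
have c0 := inv_ln2_gt0 (R := R).
exists (1 + (ln 2)^-1 + (ln 2)^-1 ^+ 2) => [|].
  by rewrite !addr_gt0 ?exprn_gt0.
split=> [k k0|n]; last exact: depth_le_Log.
apply: le_trans (trunc_log_le_Log k0) _.
rewrite ler_wpM2r ?(le_trans ler01 (Log_ge1 _)) //.
by have := sqr_ge0 ((ln 2)^-1 : R); lra.
Qed.

End Assembly.

Local Open Scope classical_set_scope.

Theorem theorem3 (R : realType) :
  exists (C : R) (c : nat), 0 < C /\ (0 < c)%N /\
  forall (n k : nat), (1 <= k)%N ->
  exists (d : measure_display) (Omega : measurableType d)
         (P : probability Omega R) (A : adaptive_alg R Omega n),
    (* O(log log n) rounds *)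
    ((rounds A)%:R <= C * Log (Log (n%:R : R))) /\
    (* O(k log k + k log log n) adaptive linear measurements, in every run *)
    (forall (w : Omega) (x : 'rV[R]_n),
       (num_measurements A w x)%:R
         <= C * (k%:R * Log (k%:R : R) + k%:R * Log (Log (n%:R : R)))) /\
    (* success with probability 1 - 1/poly(k) *)
    (forall x : 'rV[R]_n,
       let good := [set w : Omega |
                     norm_inf (x - run A w x) ^+ 2
                       <= k%:R^-1 * norm2_sq (tail_vec k x)] in
       measurable good /\
       ((1 - (k%:R ^+ c)^-1)%:E <= P good)%E).
Proof.
have [c c0 [trunc_le depth_le]] := log_constant (R := R).
(* The summands cover the sketch, the probes with the final readings, and the rounds; [4096] and
   [2052] are [1024] and [513] times the 4 of [sparsity_le]. Exponent 1 reflects failure probability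
   at most [1 / k]. *)
exists (4096 * (13 * c + 64) + 2052 * (8 * c + 1) + (4 * c + 2)), 1%N; split.
  by have := c0; lra.
split=> // n k k0.
have [seed [P PE]] := uniform_seed (R := R) (card_all_seeds n k).
exists default_measure_display, nat, P, (full_recovery seed).
have L1 := Log_ge1 (Log (n%:R : R)); have K1 := Log_ge1 (k%:R : R).
have kR : 1 <= k%:R :> R by rewrite ler1n.
split; [|split].
- rewrite /= -addn2 natrD natrM.
  apply: (@le_trans _ _ ((4 * c + 2) * Log (Log (n%:R : R)))).
    by have := depth_le n; lra.
  by rewrite ler_wpM2r ?(le_trans ler01 L1) //; have := c0; lra.
- move=> w x.
  apply: (@le_trans _ _ (trials k * (1024 * sparsity k)
      + 4 * depth n * (2 * (513 * sparsity k)) + 513 * sparsity k)%N%:R).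
    by rewrite ler_nat; exact: recovery_measurements.
  apply: (@le_trans _ _ ((trials k)%:R * 4096 * k%:R +
      (8 * (depth n)%:R + 1) * 2052 * k%:R)).
    exact/measurement_total/sparsity_le.
  have Tle : (trials k)%:R <= (13 * c + 64) * Log (k%:R : R).
    have -> : trials k = (13 * trunc_log 2 k + 64)%N.
      by rewrite /trials /base_exp /level; lia.
    by rewrite natrD natrM; have := trunc_le k k0; lra.
  have Dle : 8 * (depth n)%:R + 1 <= (8 * c + 1) * Log (Log (n%:R : R)).
    by have := depth_le n; lra.
  have kT := ler_wpM2r (le_trans ler01 kR) Tle.
  have kD := ler_wpM2r (le_trans ler01 kR) Dle.
  have kL : 0 <= k%:R * Log (k%:R : R) by rewrite mulr_ge0 // (le_trans ler01).
  have kLL : 0 <= k%:R * Log (Log (n%:R : R)) by rewrite mulr_ge0 // (le_trans ler01).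
  have ckL := mulr_ge0 (ltW c0) kL; have ckLL := mulr_ge0 (ltW c0) kLL.
  lra.
- move=> x good; split => //.
  (* The scale may depend on [x]: it enters only the failure event, and the algorithm was fixed
     before. *)
  have [s [s0 ts hs]] := heavy_scale k x.
  apply: (@le_trans _ _ (P [set i | ~~ full_fail x s (seed i)])).
    rewrite (PE (fun w => ~~ full_fail x s w)) Pr_setC ?card_all_seeds // lee_fin expr1 lerB //.
    exact: full_recovery_fail.
  apply: le_measure; rewrite ?inE // => w /= Fw.
  exact: full_recovery_error hs Fw.
Qed.
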